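(* Let $m<n$ be positive integers, $\bm{A}\in\mathbb{R}^{m\times n}$, $0<\alpha\le 1$, $s\in\{1,\dots,n\}$, and let $k>0$ be a real number such that $ks$ is a positive integer and $a(s,ks;\alpha):=\frac{\sqrt{ks}-\alpha}{\sqrt{s}+\alpha}>1$. Let $\bm{x}\in\mathbb{R}^n$ be $s$-sparse and let $\bm{b}=\bm{A}\bm{x}$. If the $(\ell_2,\ell_1)$ restricted isometry constants of $\bm{A}$ satisfy $$\delta_{ks}^{ub}+a(s,ks;\alpha)\,\delta_{(k+1)s}^{lb}<a(s,ks;\alpha)-1,$$ then the minimization problem $$\min_{\bm{u}\in\mathbb{R}^n}\ \|\bm{u}\|_1-\alpha\|\bm{u}\|_2\quad\text{subject to}\quad \bm{A}\bm{u}=\bm{b}$$ has a unique solution, namely the $s$-sparse vector $\bm{x}$.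
   Context: A vector is $s$-sparse if it has at most $s$ nonzero coordinates. For a matrix $\bm{A}\in\mathbb{R}^{m\times n}$ and a positive integer $r$, the $(\ell_2,\ell_1)$ restricted isometry constants $\delta_r^{lb}$ and $\delta_r^{ub}$ of order $r$ are the smallest real numbers such that $$(1-\delta_r^{lb})\|\bm{u}\|_2\le\|\bm{A}\bm{u}\|_1\le(1+\delta_r^{ub})\|\bm{u}\|_2$$ for all $r$-sparse $\bm{u}\in\mathbb{R}^n$. *)

(* Defs.v *)
From mathcomp Require Import all_boot all_order all_algebra.
From mathcomp Require Import classical_sets reals.
Set Implicit Arguments.
Unset Strict Implicit.
Unset Printing Implicit Defensive.
Import Order.TTheory GRing.Theory Num.Theory.
Local Open Scope classical_set_scope.
Local Open Scope ring_scope.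

(* The norm `|u| that MathComp-Analysis puts on matrices is the sup norm, so
   the l1 and l2 norms are spelled out here. *)
Definition norm1 (R : realType) (n : nat) (u : 'cV[R]_n) : R :=
  \sum_(i < n) `|u i 0|.

Definition norm2 (R : realType) (n : nat) (u : 'cV[R]_n) : R :=
  Num.sqrt (\sum_(i < n) u i 0 ^+ 2).

Definition sparse (R : realType) (n s : nat) (u : 'cV[R]_n) : bool :=
  (#|[pred i : 'I_n | (u i 0 != 0)%R]| <= s)%N.

(* (l2, l1) restricted isometry constants of order r. The infima are minima as
   soon as 0 < n and 0 < r: see ric_lb_least and ric_ub_least. For r > n the
   sparsity restriction is void. *)
Definition ric_lb_set (R : realType) (m n : nat) (A : 'M[R]_(m, n)) (r : nat)
    : set R :=
  [set d | forall u : 'cV[R]_n,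
     sparse r u -> (1 - d) * norm2 u <= norm1 (A *m u)].

Definition ric_ub_set (R : realType) (m n : nat) (A : 'M[R]_(m, n)) (r : nat)
    : set R :=
  [set d | forall u : 'cV[R]_n,
     sparse r u -> norm1 (A *m u) <= (1 + d) * norm2 u].

Definition ric_lb (R : realType) (m n : nat) (A : 'M[R]_(m, n)) (r : nat) : R :=
  inf (ric_lb_set A r).

Definition ric_ub (R : realType) (m n : nat) (A : 'M[R]_(m, n)) (r : nat) : R :=
  inf (ric_ub_set A r).

(* The second argument is the (real) value of the product k s. *)
Definition ratio_a (R : realType) (s ks alpha : R) : R :=
  (Num.sqrt ks - alpha) / (Num.sqrt s + alpha).

Definition solutions (R : realType) (m n : nat) (A : 'M[R]_(m, n))
    (b : 'cV[R]_m) (alpha : R) : set 'cV[R]_n :=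
  [set u | A *m u = b /\
     forall v : 'cV[R]_n, A *m v = b ->
       norm1 u - alpha * norm2 u <= norm1 v - alpha * norm2 v].

Lemma norm2_ge0 (R : realType) (n : nat) (u : 'cV[R]_n) : 0 <= norm2 u.
Proof. exact: sqrtr_ge0. Qed.

Lemma norm1_ge0 (R : realType) (n : nat) (u : 'cV[R]_n) : 0 <= norm1 u.
Proof. exact: sumr_ge0. Qed.

Lemma norm2_eq0 (R : realType) (n : nat) (u : 'cV[R]_n) :
  norm2 u = 0 -> u = 0.
Proof.
move=> u0; have sq0 (i : 'I_n) : true -> 0 <= u i 0 ^+ 2 by rewrite sqr_ge0.
have /eqP : \sum_(i < n) u i 0 ^+ 2 = 0.
  apply/eqP; rewrite eq_le sumr_ge0 // andbT.
  by move/eqP: u0; rewrite sqrtr_eq0.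
rewrite psumr_eq0 // => /allP h; apply/matrixP => i j; rewrite ord1 mxE.
by apply/eqP; rewrite -sqrf_eq0; apply: h; rewrite mem_index_enum.
Qed.

Lemma ler_entry_norm2 (R : realType) (n : nat) (u : 'cV[R]_n) (i : 'I_n) :
  `|u i 0| <= norm2 u.
Proof.
rewrite -sqrtr_sqr ler_wsqrtr // (bigD1 i) //= lerDl.
by apply: sumr_ge0 => j _; rewrite sqr_ge0.
Qed.

Lemma norm1_mulmx_bounded (R : realType) (m n : nat) (A : 'M[R]_(m, n))
    (u : 'cV[R]_n) :
  norm1 (A *m u) <= (\sum_(i < m) \sum_(j < n) `|A i j|) * norm2 u.
Proof.
rewrite mulr_suml; apply: ler_sum => i _.
rewrite mxE mulr_suml; apply: le_trans (ler_norm_sum _ _ _) _.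
by apply: ler_sum => j _; rewrite normrM ler_wpM2l ?ler_entry_norm2.
Qed.

Lemma sparse_unit (R : realType) (n r : nat) (n_gt0 : (0 < n)%N)
    (r_gt0 : (0 < r)%N) :
  exists2 u : 'cV[R]_n, sparse r u & norm2 u = 1.
Proof.
pose i0 := Ordinal n_gt0; exists (delta_mx i0 0).
  rewrite /sparse; apply: (@leq_trans #|pred1 i0|); last by rewrite card1.
  apply: subset_leq_card.
  apply/fintype.subsetP => i; rewrite !inE mxE andbT; case: (i == i0) => //.
  by rewrite eqxx.
rewrite /norm2 (bigD1 i0) //= mxE !eqxx expr1n big1 ?addr0 ?sqrtr1 // => i ne.
by rewrite mxE (negbTE ne) expr0n.
Qed.

Lemma ric_lb_least (R : realType) (m n : nat) (A : 'M[R]_(m, n)) (r : nat) :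
  (0 < n)%N -> (0 < r)%N ->
  ric_lb_set A r (ric_lb A r) /\ lbound (ric_lb_set A r) (ric_lb A r).
Proof.
move=> n0 r0; have [e es e1] := sparse_unit R n0 r0.
have hl : has_lbound (ric_lb_set A r).
  exists (1 - norm1 (A *m e)) => d /(_ e es).
  by rewrite e1 mulr1 lerBlDr addrC -lerBlDr.
split; last exact: ge_inf.
move=> u us; have := norm2_ge0 u; rewrite le_eqVlt => /predU1P[<-|u0].
  by rewrite mulr0 norm1_ge0.
rewrite -ler_pdivlMr // lerBlDr addrC -lerBlDr.
apply: lb_le_inf; first by exists 1 => v _; rewrite subrr mul0r norm1_ge0.
by move=> d /(_ u us); rewrite -ler_pdivlMr // lerBlDr addrC -lerBlDr.
Qed.

Lemma ric_ub_least (R : realType) (m n : nat) (A : 'M[R]_(m, n)) (r : nat) :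
  (0 < n)%N -> (0 < r)%N ->
  ric_ub_set A r (ric_ub A r) /\ lbound (ric_ub_set A r) (ric_ub A r).
Proof.
move=> n0 r0; have [e es e1] := sparse_unit R n0 r0.
have hl : has_lbound (ric_ub_set A r).
  exists (norm1 (A *m e) - 1) => d /(_ e es).
  by rewrite e1 mulr1 lerBlDl.
split; last exact: ge_inf.
move=> u us; have := norm2_ge0 u; rewrite le_eqVlt => /predU1P[/esym u0|u0].
  rewrite u0 mulr0 (norm2_eq0 u0) mulmx0 /norm1 big1 // => i _.
  by rewrite mxE normr0.
rewrite -ler_pdivrMr // -lerBlDl.
apply: lb_le_inf; last first.
  by move=> d /(_ u us); rewrite -ler_pdivrMr // -lerBlDl.
exists (\sum_(i < m) \sum_(j < n) `|A i j| - 1) => v _.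
by rewrite addrC subrK norm1_mulmx_bounded.
Qed.

(* Main.v *)
Require Import Defs.
From mathcomp Require Import all_boot all_order all_algebra.
From mathcomp Require Import classical_sets reals.
From mathcomp Require Import ring lra.
From mathcomp Require Import fintype finset.
Set Implicit Arguments.
Unset Strict Implicit.
Unset Printing Implicit Defensive.
Import Order.TTheory GRing.Theory Num.Theory.
Local Open Scope ring_scope.

(** Suppose that [x + v] is feasible, so [A *m v = 0], and that it is at least
as good as [x].  Let [T] be the support of [x] and [U] its complement.  The
triangle inequalities for the two norms give the cone condition
  [|v_U|_1 - alpha |v_U|_2 <= (sqrt s + alpha) |v_T|_2]
([cone_condition]).

Cut [U] into consecutive blocks [P, P_2, P_3, ...] of [ks] indices (fewer in the
last), by decreasing magnitude of [v]. The magnitudes in a block are at most the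
smallest magnitude [t] in the block before it, so its l2 norm is at most [sqrt
ks * t]. Since [alpha <= 1], [|w|_1 - alpha |w|_2] is smallest, among the [w]
supported on [ks] given indices with all entries there of magnitude at least
[t], when these magnitudes all equal [t] ([penalty_flat_lb]); its value is then
[(sqrt ks - alpha) * sqrt ks * t]. Hence [sqrt ks - alpha] times the l2 norm of
a block is at most the l1-l2 penalty of the preceding block, and summing over
the blocks,
  [(sqrt ks - alpha) (|v_{P_2}|_2 + |v_{P_3}|_2 + ...)
     <= |v_U|_1 - alpha |v_U|_2].
With the upper isometry constant on each block, this bounds the l1 norm of
[A *m v_{U \ P}] ([block_decomposition]).

Since [A *m v = 0], that l1 norm is also the one of [A *m v_{T u P}], which the
lower constant bounds from below.  Together, with [z = |v_{T u P}|_2],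
  [(sqrt ks - alpha) (1 - lb) z <= (sqrt s + alpha) (1 + ub) z],
and the hypothesis on the constants is the opposite strict inequality between
the two coefficients.  So [v] vanishes on [T] and [P]; the bound on the tail
then makes it vanish on the other blocks too ([null_space_trivial]). *)

(** * The l1 and l2 norms *)

Section Norms.
Variables (R : realType) (n : nat).
Implicit Types (u v w x : 'cV[R]_n) (U P : {set 'I_n}).

Lemma norm2_sqr u : norm2 u ^+ 2 = \sum_(i < n) u i 0 ^+ 2.
Proof. by rewrite sqr_sqrtr // sumr_ge0 // => i _; rewrite sqr_ge0. Qed.

Lemma norm2_0 : norm2 (0 : 'cV[R]_n) = 0.
Proof. by rewrite /norm2 big1 ?sqrtr0 // => i _; rewrite mxE expr0n. Qed.

Lemma norm1N u : norm1 (- u) = norm1 u.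
Proof. by apply: eq_bigr => i _; rewrite mxE normrN. Qed.

Lemma ler_norm1D u v : norm1 (u + v) <= norm1 u + norm1 v.
Proof.
by rewrite -big_split /=; apply: ler_sum => i _; rewrite mxE ler_normD.
Qed.

(** Expand the nonnegative sum of the squared entries of
[norm2 v *: u - norm2 u *: v]. *)
Lemma cauchy_schwarz u v :
  \sum_(i < n) u i 0 * v i 0 <= norm2 u * norm2 v.
Proof.
have [u0|u_neq0] := eqVneq (norm2 u) 0.
  by rewrite u0 mul0r (norm2_eq0 u0) big1 // => i _; rewrite mxE mul0r.
have [v0|v_neq0] := eqVneq (norm2 v) 0.
  by rewrite v0 mulr0 (norm2_eq0 v0) big1 // => i _; rewrite mxE mulr0.
have u_gt0 : 0 < norm2 u by rewrite lt_def u_neq0 norm2_ge0.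
have v_gt0 : 0 < norm2 v by rewrite lt_def v_neq0 norm2_ge0.
have : 0 <= \sum_(i < n) (norm2 v * u i 0 - norm2 u * v i 0) ^+ 2.
  by apply: sumr_ge0 => i _; rewrite sqr_ge0.
have -> : \sum_(i < n) (norm2 v * u i 0 - norm2 u * v i 0) ^+ 2 =
    2 * (norm2 u * norm2 v) *
    (norm2 u * norm2 v - \sum_(i < n) u i 0 * v i 0).
  transitivity (\sum_(i < n) (norm2 v ^+ 2 * u i 0 ^+ 2 +
      norm2 u ^+ 2 * v i 0 ^+ 2 -
      2 * (norm2 u * norm2 v) * (u i 0 * v i 0))).
    by apply: eq_bigr => i _; ring.
  by rewrite sumrB big_split /= -!mulr_sumr -!norm2_sqr; ring.
by rewrite pmulr_rge0 ?subr_ge0 // !mulr_gt0.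
Qed.

Lemma ler_norm2D u v : norm2 (u + v) <= norm2 u + norm2 v.
Proof.
rewrite -(@ler_pXn2r _ 2) ?nnegrE ?addr_ge0 ?norm2_ge0 // norm2_sqr.
have -> : \sum_(i < n) (u + v) i 0 ^+ 2 =
    norm2 u ^+ 2 + norm2 v ^+ 2 + 2 * \sum_(i < n) u i 0 * v i 0.
  rewrite !norm2_sqr mulr_sumr -!big_split /=.
  by apply: eq_bigr => i _; rewrite mxE; ring.
by have := cauchy_schwarz u v; lra.
Qed.

Lemma ler_norm2_norm1 u : norm2 u <= norm1 u.
Proof.
rewrite -(@ler_pXn2r _ 2) ?nnegrE ?norm1_ge0 ?norm2_ge0 // norm2_sqr.
rewrite expr2 mulr_suml; apply: ler_sum => i _.
rewrite -real_normK ?num_real // expr2 ler_wpM2l //.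
by rewrite /norm1 (bigD1 i) //= lerDl sumr_ge0.
Qed.

(** Cauchy-Schwarz against the vector of signs of [u], which has at most [s]
nonzero entries. *)
Lemma norm1_sparse s u : sparse s u -> norm1 u <= Num.sqrt s%:R * norm2 u.
Proof.
move=> us; pose e : 'cV[R]_n := \col_i Num.sg (u i 0).
have -> : norm1 u = \sum_(i < n) e i 0 * u i 0.
  by apply: eq_bigr => i _; rewrite mxE normrEsg.
apply: le_trans (cauchy_schwarz e u) _; rewrite ler_wpM2r ?norm2_ge0 //.
rewrite ler_wsqrtr //; apply: le_trans (_ : (\sum_(i | u i 0 != 0) 1) <= _).
  rewrite [leRHS]big_mkcond /=; apply: ler_sum => i _.
  by rewrite mxE sqr_sg; case: (u i 0 != 0).
by rewrite sumr_const ler_nat.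
Qed.

Lemma norm2_sparse r u t : sparse r u -> 0 <= t ->
  (forall i, `|u i 0| <= t) -> norm2 u <= Num.sqrt r%:R * t.
Proof.
move=> ur t0 ut; have rt_ge0 : 0 <= Num.sqrt r%:R * t.
  by rewrite mulr_ge0 ?sqrtr_ge0.
rewrite -(@ler_pXn2r _ 2) ?nnegrE ?norm2_ge0 // norm2_sqr.
rewrite exprMn sqr_sqrtr //.
apply: le_trans (_ : (\sum_(i | u i 0 != 0) t ^+ 2) <= _).
  rewrite [leRHS]big_mkcond /=; apply: ler_sum => i _.
  case: eqP => [->|_] /=; first by rewrite expr0n.
  by rewrite -real_normK ?num_real // lerXn2r ?nnegrE.
rewrite sumr_const -[_ *+ _]mulr_natl.
by rewrite ler_wpM2r ?sqr_ge0 // ler_nat.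
Qed.

(** * Restriction to a set of coordinates *)

Definition restr v U : 'cV[R]_n := \col_i (if i \in U then v i 0 else 0).

Lemma restr0 v : restr v set0 = 0.
Proof. by apply/colP => i; rewrite !mxE inE. Qed.

Lemma restrT v : restr v setT = v.
Proof. by apply/colP => i; rewrite !mxE inE. Qed.

Lemma restr_split v {P U} : P \subset U ->
  restr v U = restr v P + restr v (U :\: P).
Proof.
move=> /subsetP PU; apply/colP => i; rewrite !mxE inE.
have [/PU -> /=|_ /=] := boolP (i \in P); first by rewrite addr0.
by rewrite add0r.
Qed.

Lemma norm1_restr_split v {P U} : P \subset U ->
  norm1 (restr v U) = norm1 (restr v P) + norm1 (restr v (U :\: P)).
Proof.
move=> /subsetP PU; rewrite -big_split /=; apply: eq_bigr => i _.
rewrite !mxE inE; have [/PU -> /=|_ /=] := boolP (i \in P).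
  by rewrite normr0 addr0.
by rewrite normr0 add0r.
Qed.

Lemma ler_norm2_restr v {P U} : P \subset U ->
  norm2 (restr v P) <= norm2 (restr v U).
Proof.
move=> /subsetP PU; apply: ler_wsqrtr; apply: ler_sum => i _.
rewrite !mxE; have [/PU -> //|_] := boolP (i \in P).
by rewrite expr0n sqr_ge0.
Qed.

Lemma sparse_restr r v U : (#|U| <= r)%N -> sparse r (restr v U).
Proof.
apply: leq_trans; apply: subset_leq_card; apply/subsetP => i.
by rewrite !inE mxE; case: (i \in U) => //; rewrite eqxx.
Qed.

(** * The l1-l2 penalty *)

Section Penalty.
Variable alpha : R.
Hypotheses (alpha_ge0 : 0 <= alpha) (alpha_le1 : alpha <= 1).

Definition penalty u : R := norm1 u - alpha * norm2 u.

Lemma penalty_ge0 u : 0 <= penalty u.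
Proof.
rewrite subr_ge0; apply: le_trans (ler_norm2_norm1 u).
by rewrite ler_piMl ?norm2_ge0.
Qed.

(** The l1 part is additive on disjoint supports, and the subtracted l2 part is
subadditive. *)
Lemma penalty_split v {P U} : P \subset U ->
  penalty (restr v P) + penalty (restr v (U :\: P)) <= penalty (restr v U).
Proof.
move=> PU; rewrite /penalty (norm1_restr_split v PU) (restr_split v PU).
have := ler_wpM2l alpha_ge0 (ler_norm2D (restr v P) (restr v (U :\: P))).
by lra.
Qed.

(** Splitting the magnitudes on [P] as [t + e] with [e >= 0], the l1 norm
increases by exactly [|e|_1] over its value at the constant [t], and the l2 norm
by at most [|e|_2 <= |e|_1]. *)
Lemma penalty_flat_lb v P t : 0 <= t -> (forall i, i \in P -> t <= `|v i 0|) ->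
  (Num.sqrt #|P|%:R - alpha) * (Num.sqrt #|P|%:R * t) <= penalty (restr v P).
Proof.
move=> t0 tP; pose c : 'cV[R]_n := restr (const_mx t) P.
pose e : 'cV[R]_n := restr (\col_i (`|v i 0| - t)) P.
have n1 : norm1 (restr v P) = #|P|%:R * t + norm1 e.
  rewrite mulr_natl -sumr_const [X in _ = X + _]big_mkcond -big_split /=.
  apply: eq_bigr => i _; rewrite !mxE; case: ifPn => iP; last first.
    by rewrite normr0 addr0.
  by rewrite [X in _ = _ + X]ger0_norm ?subr_ge0 ?tP // addrC subrK.
have n2 : norm2 (restr v P) = norm2 (c + e).
  congr Num.sqrt; apply: eq_bigr => i _; rewrite !mxE; case: ifP => _.
    by rewrite addrC subrK real_normK ?num_real.
  by rewrite addr0.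
have nc : norm2 c <= Num.sqrt #|P|%:R * t.
  apply: norm2_sparse => // [|i]; first exact: sparse_restr.
  by rewrite !mxE; case: ifP => _; rewrite ?normr0 // ger0_norm.
have -> : (Num.sqrt #|P|%:R - alpha) * (Num.sqrt #|P|%:R * t) =
          #|P|%:R * t - alpha * (Num.sqrt #|P|%:R * t).
  by rewrite mulrBl mulrA -expr2 sqr_sqrtr.
have n2_le : norm2 (c + e) <= Num.sqrt #|P|%:R * t + norm1 e.
  exact: le_trans (ler_norm2D c e) (lerD nc (ler_norm2_norm1 e)).
have alpha_e : alpha * norm1 e <= norm1 e by rewrite ler_piMl ?norm1_ge0.
have := ler_wpM2l alpha_ge0 n2_le; rewrite /penalty n1 n2; lra.
Qed.

(** * Blocks of decreasing magnitude *)

Lemma largest_entries (f : 'I_n -> R) U r : (r <= #|U|)%N ->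
  exists P t, [/\ P \subset U, #|P| = r, forall i, i \in P -> t <= f i &
    forall i, i \in U :\: P -> f i <= t].
Proof.
elim: r => [_|r IHr r_lt].
  (* No entry is selected yet: [t] is any upper bound of [f]. *)
  exists set0, (\sum_i `|f i|).
  split=> [||i|i _]; rewrite ?sub0set ?cards0 ?inE //.
  rewrite (bigD1 i) //= (le_trans (ler_norm _)) // lerDl.
  exact: sumr_ge0.
have [P [t [PU cP tP Pt]]] := IHr (ltnW r_lt).
have : (0 < #|U :\: P|)%N.
  by rewrite cardsDS // cP subn_gt0.
case/card_gt0P => i0 i0P.
case: (arg_maxP f i0P) => j jP jmax; exists (j |: P), (f j).
have /setDP[jU jnP] : j \in U :\: P := jP; split.
- by rewrite subUset sub1set jU.
- by rewrite cardsU1 jnP cP.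
- move=> i; rewrite !inE => /predU1P[-> //|iP].
  by rewrite (le_trans (Pt j jP)) ?tP.
- move=> i; rewrite !inE negb_or -andbA => /and3P[_ inP iU].
  have iUP : i \in U :\: P by rewrite inE inP.
  exact: jmax.
Qed.

(** [P] is a block of [r] largest magnitudes on [U], or all of [U] if that is
smaller. The functional [N] stands for a seminorm controlled by the l2 norm on
[r]-sparse vectors; keeping it abstract, and quantified after [P], gives one
block that serves both for the l1 norm of the image by a matrix and for the l2
norm. In the induction, the first block [P'] of the rest has l2 norm at most
[sqrt r * t], where [t] separates the entries on [P] from the others, and the
penalty of [P] pays for it. *)
Lemma block_decomposition r v U : alpha <= Num.sqrt r%:R -> (0 < r)%N ->
  exists P, [/\ P \subset U, (#|P| <= r)%N &
    forall (N : 'cV[R]_n -> R) (C : R), 0 <= C ->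
      (forall u w, N (u + w) <= N u + N w) ->
      (forall u, sparse r u -> N u <= C * norm2 u) ->
      (Num.sqrt r%:R - alpha) * N (restr v (U :\: P)) <=
        C * penalty (restr v U)].
Proof.
move=> alpha_le r_gt0; have [k] := ubnP #|U|.
have r_alpha_ge0 : 0 <= Num.sqrt r%:R - alpha by rewrite subr_ge0.
elim: k U => // k IHk U cU.
have [Ur|rU] := leqP #|U| r.
  exists U; split=> // N C C_ge0 _ NC; rewrite setDv restr0.
  apply: le_trans (mulr_ge0 C_ge0 (penalty_ge0 _)); rewrite mulr_ge0_le0 //.
  rewrite (le_trans (NC 0 _)) ?norm2_0 ?mulr0 //.
  by rewrite -(restr0 0) sparse_restr // cards0.
have [P [t [PU cP tP Pt]]] := largest_entries (fun i => `|v i 0|) (ltnW rU).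
exists P; split=> //; first by rewrite cP.
move=> N C C_ge0 ND NC.
have UP_gt0 : (0 < #|U :\: P|)%N by rewrite cardsDS // cP subn_gt0.
have t_ge0 : 0 <= t by case/card_gt0P: UP_gt0 => j /Pt; apply: le_trans.
have cUP : (#|U :\: P| < k)%N.
  rewrite -ltnS; apply: leq_trans cU.
  by rewrite !ltnS cardsDS // cP ltn_subrL r_gt0 (leq_ltn_trans _ rU).
have [P' [P'UP cP' /(_ N C C_ge0 ND NC) tail]] := IHk _ cUP.
have headP' : norm2 (restr v P') <= Num.sqrt r%:R * t.
  apply: norm2_sparse => // [|i]; first exact: sparse_restr.
  rewrite mxE; case: ifP => [/(subsetP P'UP)/Pt //|_].
  by rewrite normr0.
have penP := penalty_flat_lb t_ge0 tP; rewrite cP in penP.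
have NP' : N (restr v P') <= C * (Num.sqrt r%:R * t).
  by rewrite (le_trans (NC _ (sparse_restr v cP'))) // ler_wpM2l.
apply: (@le_trans _ _ ((Num.sqrt r%:R - alpha) *
    (N (restr v P') + N (restr v ((U :\: P) :\: P'))))).
  by rewrite (restr_split v P'UP) ler_wpM2l.
rewrite mulrDr; apply: le_trans (lerD (ler_wpM2l r_alpha_ge0 NP') tail) _.
rewrite mulrCA -mulrDr ler_wpM2l //.
by apply: le_trans (penalty_split v PU); rewrite lerD2r.
Qed.

(** Passing from [x] to [x + v], the l1 norm drops by at most [|v_T|_1] on the
support [T] of [x] and grows by exactly [|v|_1] off it, while the l2 norm grows
by at most [|v|_2], itself at most the sum of the l2 norms of the two parts of
[v]. *)
Lemma cone_condition s x v (T := [set i | x i 0 != 0]) : sparse s x ->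
  penalty (x + v) <= penalty x ->
  penalty (restr v (~: T)) <= (Num.sqrt s%:R + alpha) * norm2 (restr v T).
Proof.
move=> xs; rewrite /penalty => le_xv.
have cT : (#|T| <= s)%N by rewrite cardsE.
have n1 : norm1 x + norm1 (restr v (~: T)) <=
    norm1 (x + v) + norm1 (restr v T).
  rewrite -!big_split /=; apply: ler_sum => i _; rewrite !mxE !inE.
  case: eqP => [->|_] /=; first by rewrite normr0 !add0r addr0.
  rewrite normr0 addr0 -[X in `|X| <= _](addrK (v i 0)).
  exact: ler_normB.
have n1T := norm1_sparse (sparse_restr v cT).
have vE : v = restr v T + restr v (~: T).
  by rewrite -setTD -restr_split ?restrT ?subsetT.
have := ler_wpM2l alpha_ge0 (ler_norm2D x v).
have := ler_wpM2l alpha_ge0 (ler_norm2D (restr v T) (restr v (~: T))).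
rewrite -vE; lra.
Qed.

End Penalty.
End Norms.

(** * Recovery *)

Section Recovery.
Variables (R : realType) (m n : nat) (A : 'M[R]_(m, n)) (alpha : R).
Variables (s r : nat).
Hypotheses (n_gt0 : (0 < n)%N) (r_gt0 : (0 < r)%N).
Hypotheses (alpha_gt0 : 0 < alpha) (alpha_le1 : alpha <= 1).
Hypothesis a_gt1 : 1 < ratio_a s%:R r%:R alpha.
Hypothesis ric_lt : ric_ub A r + ratio_a s%:R r%:R alpha * ric_lb A (r + s)
                      < ratio_a s%:R r%:R alpha - 1.

Let p : R := Num.sqrt r%:R - alpha.
Let q : R := Num.sqrt s%:R + alpha.

Lemma ric_ub_ge_opp1 : 0 <= 1 + ric_ub A r.
Proof.
have [ub _] := ric_ub_least A n_gt0 r_gt0.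
have [e er e1] := sparse_unit R n_gt0 r_gt0.
by have := ub e er; rewrite e1 mulr1; apply: le_trans; exact: norm1_ge0.
Qed.

(** The block decomposition is used twice: for the l1 norm of the image by [A],
which gives [v = 0] on the support of [x] and on the first block, and then for
the l2 norm, whose bound by the cone condition is now [0]. *)
Lemma null_space_trivial x v : sparse s x -> A *m v = 0 ->
  penalty alpha (x + v) <= penalty alpha x -> v = 0.
Proof.
move=> xs Av0 le_xv.
have q_gt0 : 0 < q by rewrite ltr_wpDl ?sqrtr_ge0.
have p_gt0 : 0 < p.
  by move: a_gt1; rewrite /ratio_a ltr_pdivlMr // mul1r; apply: lt_trans.
(* The hypothesis on the constants, multiplied by the denominator of [a]. *)
have coef : (1 + ric_ub A r) * q < p * (1 - ric_lb A (r + s)).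
  have aq : ratio_a s%:R r%:R alpha * q = p by rewrite divfK ?gt_eqF.
  by rewrite -aq; move: ric_lt q_gt0; nra.
have cone := cone_condition (ltW alpha_gt0) xs le_xv.
set T := [set i | x i 0 != 0] in cone.
have alpha_r : alpha <= Num.sqrt r%:R by rewrite -subr_ge0 ltW.
have [P [PU cP tail]] :=
  block_decomposition (ltW alpha_gt0) alpha_le1 v (~: T) alpha_r r_gt0.
pose S := T :|: P.
have cS : (#|S| <= r + s)%N.
  rewrite addnC (leq_trans (leq_card_setU _ _)) // leq_add //.
  by rewrite cardsE.
have restS : v = restr v S + restr v (~: T :\: P).
  rewrite -[LHS]restrT (restr_split v (subsetT S)); congr (_ + restr v _).
  by rewrite setTD setCU setDE.
have tail_head : norm1 (A *m restr v (~: T :\: P)) = norm1 (A *m restr v S).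
  rewrite -[RHS]norm1N; congr norm1; apply/eqP.
  by rewrite -addr_eq0 addrC -mulmxDr -restS Av0.
have [lb _] := ric_lb_least A n_gt0 (ltn_addr s r_gt0).
have [ub _] := ric_ub_least A n_gt0 r_gt0.
have head := lb _ (sparse_restr v cS).
have Atail := tail (fun u => norm1 (A *m u)) _ ric_ub_ge_opp1 _ ub.
have TS := ler_norm2_restr v (subsetUl T P).
have z_ge0 := norm2_ge0 (restr v S).
have z0 : norm2 (restr v S) = 0.
  apply/eqP; rewrite eq_le z_ge0 andbT.
  have {}Atail : p * norm1 (A *m restr v S) <=
      (1 + ric_ub A r) * (q * norm2 (restr v S)).
    rewrite -tail_head; apply: le_trans (Atail _) _.
      by move=> u w; rewrite mulmxDr ler_norm1D.
    rewrite ler_wpM2l ?ric_ub_ge_opp1 // (le_trans cone) // ler_wpM2l //.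
    exact: ltW.
  have := ler_wpM2l (ltW p_gt0) head; nra.
have tail0 : norm2 (restr v (~: T :\: P)) = 0.
  have T0 : norm2 (restr v T) = 0.
    by apply/eqP; rewrite eq_le norm2_ge0 andbT -z0.
  have n2_bound (u : 'cV[R]_n) : sparse r u -> norm2 u <= 1 * norm2 u.
    by rewrite mul1r.
  have := tail (@norm2 R n) 1 ler01 (@ler_norm2D R n) n2_bound.
  rewrite T0 mulr0 in cone; rewrite mul1r => /le_trans /(_ cone).
  rewrite pmulr_rle0 // => t0.
  by apply/eqP; rewrite eq_le norm2_ge0 t0.
by rewrite restS (norm2_eq0 z0) (norm2_eq0 tail0) addr0.
Qed.

End Recovery.

Local Open Scope classical_set_scope.
Local Open Scope ring_scope.

(* The natural number ks is the value of the product k * s; hence the order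
   (k + 1) s is ks + s. *)
Theorem theorem1 (R : realType) (m n : nat) (A : 'M[R]_(m, n)) (alpha : R)
    (s ks : nat) (k : R) (x : 'cV[R]_n) (b : 'cV[R]_m)
    (m_gt0 : (0 < m)%N) (m_lt_n : (m < n)%N)
    (alpha_gt0 : 0 < alpha) (alpha_le1 : alpha <= 1)
    (s_gt0 : (0 < s)%N) (s_le_n : (s <= n)%N)
    (k_gt0 : 0 < k) (ks_gt0 : (0 < ks)%N) (ksE : k * s%:R = ks%:R)
    (a_gt1 : 1 < ratio_a s%:R (k * s%:R) alpha)
    (x_sparse : sparse s x) (bE : b = A *m x)
    (ric_lt : ric_ub A ks + ratio_a s%:R (k * s%:R) alpha * ric_lb A (ks + s)
              < ratio_a s%:R (k * s%:R) alpha - 1) :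
  solutions A b alpha = [set x].
Proof.
have n_gt0 : (0 < n)%N := ltn_trans m_gt0 m_lt_n.
rewrite ksE in a_gt1 ric_lt.
have unique u : A *m u = b -> penalty alpha u <= penalty alpha x -> u = x.
  move=> Au le_ux; apply/eqP; rewrite -subr_eq0; apply/eqP.
  apply: (null_space_trivial n_gt0 ks_gt0 alpha_gt0 alpha_le1 a_gt1 ric_lt
    x_sparse).
    by rewrite mulmxBr Au bE subrr.
  by rewrite addrC subrK.
apply/seteqP; split=> [u [Au u_min]|_ ->] /=.
  by apply: unique => //; apply: u_min.
split=> // v Av.
have [le_vx|/ltW //] := leP (penalty alpha v) (penalty alpha x).
by rewrite (unique v).
Qed.
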